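(* The power graph of the symmetric group $\mathrm{Sym}(n)$ is chordal if and only if $n\leq 5$. The power graph of the alternating group $\mathrm{Alt}(n)$ is chordal if and only if $n\leq 7$.
   Context: The power graph of a group $G$ is the simple graph with vertex set $G$ in which two distinct elements $x,y$ are joined by an edge if and only if $x^m=y$ or $y^m=x$ for some $m\in\mathbb{N}$. A graph is chordal if it has no induced cycle on at least four vertices. $\mathrm{Sym}(n)$ and $\mathrm{Alt}(n)$ are the symmetric and alternating groups of degree $n$. *)

(* Defs.v *)
From mathcomp Require Import all_boot all_fingroup all_solvable.

Set Implicit Arguments.
Unset Strict Implicit.
Unset Printing Implicit Defensive.

Import GroupScope.

(* Adjacency in the power graph of the whole group [gT].  Letting [m] be 0 is
   harmless: [gT] is finite, so [x ^+ 0 = x ^+ #[x]]. *)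
Definition power_graph (gT : finGroupType) (x y : gT) : Prop :=
  x <> y /\ exists m : nat, x ^+ m = y \/ y ^+ m = x.

(* [ordS] is the successor modulo [k], so that two vertices of [c] are adjacent
   exactly when they are consecutive on the cycle. *)
Definition induced_cycle (V : Type) (e : V -> V -> Prop) (k : nat)
    (c : 'I_k -> V) : Prop :=
  injective c /\
  forall i j : 'I_k, e (c i) (c j) <-> (j = ordS i \/ i = ordS j).

Definition chordal (V : Type) (e : V -> V -> Prop) : Prop :=
  forall (k : nat) (c : 'I_k -> V), 4 <= k -> ~ induced_cycle e c.

(* Main.v *)
Require Import Defs.
From Corelib Require Import Setoid.
From mathcomp Require Import all_boot all_fingroup all_solvable.

(** Two distinct elements are adjacent in the power graph exactly when one of
    the cyclic subgroups they generate contains the other.  As this does not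
    depend on the ambient group, chordality passes to subgroups, and it is
    enough to show that Sym(5) and Alt(7) have no induced cycle of length at
    least 4, while Sym(6) and Alt(8) have one.

    Along an induced cycle, inclusions of cyclic subgroups cannot go in the same
    direction twice in a row, since transitivity would give a chord.  So every
    other vertex z is a peak, whose cyclic group contains both neighbours; these
    neighbours generate incomparable subgroups, so the order of z is not a prime
    power.  The lengths of the cycles of a permutation show that in Sym(5) and
    Alt(7) such a z has order 6 (cycle type 3+2 or 3+2+2), and that z ^+ 3 fixes
    exactly three points, on which z ^+ 2 is a 3-cycle.  Since Alt(3) is the
    only subgroup of order 3 of Sym(3), the involution z ^+ 3 determines
    <[z]>.  The two neighbours of z have orders 2 and 3, and the one of order 2
    also lies below the next peak, which then generates the same group as z: a
    contradiction ([chordal_in_order6]).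

    Conversely, let s_0, ..., s_(k-1) be a closed sequence of elements such that
    consecutive ones commute and have coprime orders.  Each s_i s_(i+1) then has
    s_i and s_(i+1) among its powers, and if it has no other s_j among them, the
    elements s_0, s_0 s_1, s_1, s_1 s_2, ... form an induced cycle of length 2k
    ([not_chordal_commuting_cycle]).  In Sym(6) one alternates transpositions
    and 3-cycles (k = 6), in Alt(8) double transpositions and 3-cycles (k = 4). *)

Set Implicit Arguments.
Unset Strict Implicit.
Unset Printing Implicit Defensive.

Import GroupScope.

(** * The power graph and subgroups *)

Lemma power_graphP (gT : finGroupType) (x y : gT) :
  power_graph x y <-> x <> y /\ (x \in <[y]> \/ y \in <[x]>).
Proof.
split=> -[neq_xy xy]; split=> //.
  by case: xy => m [<- | <-]; [right | left]; apply: mem_cycle.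
by case: xy => /cycleP[m ->]; exists m; [right | left].
Qed.

Lemma power_graph_sym (gT : finGroupType) (x y : gT) :
  power_graph x y <-> power_graph y x.
Proof.
by split=> -[neq [m xy]]; split; [exact/nesym | exists m; apply/or_comm
  | exact/nesym | exists m; apply/or_comm].
Qed.

(** Chordality of the power graph of [G], stated inside the ambient type: this
    avoids working with the elements of [subg_of G]. *)
Definition chordal_in (gT : finGroupType) (G : {group gT}) : Prop :=
  forall (k : nat) (c : 'I_k -> gT), 4 <= k -> (forall i, c i \in G) ->
  ~ induced_cycle (@power_graph gT) c.

(** An injective morphism preserves and reflects the inclusions of cyclic
    subgroups, hence maps induced cycles to induced cycles. *)
Lemma injm_chordal_in (aT rT : finGroupType) (D G : {group aT})
    (H : {group rT}) (f : {morphism D >-> rT}) :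
  'injm f -> G \subset D -> f @* G \subset H -> chordal_in H -> chordal_in G.
Proof.
move=> injf sGD sfGH chH k c k4 cG [injc adjc].
have cD i : c i \in D := subsetP sGD _ (cG i).
have fin := injmP injf.
have fH i : f (c i) \in H by rewrite (subsetP sfGH) ?mem_morphim.
apply: (chH k (f \o c)) => //; split=> [i j /= /fin/injc-> // | i j].
rewrite -adjc !power_graphP /=.
have inE i' j' : (f (c i') \in <[f (c j')]>) = (c i' \in <[c j']>).
  by rewrite -!cycle_subG /= -!morphim_cycle // injmSK ?cycle_subG.
rewrite !inE; split=> -[neq adj]; split=> //; first by apply: contra_not neq => ->.
by apply: contra_not neq => /fin->.
Qed.

Lemma chordal_inT (gT : finGroupType) :
  chordal (@power_graph gT) <-> chordal_in [set: gT].
Proof.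
split=> ch k c k4; first by move=> _; apply: ch.
by apply: ch => // i; rewrite inE.
Qed.

Lemma chordal_subg (gT : finGroupType) (G : {group gT}) :
  chordal (@power_graph (subg_of G)) <-> chordal_in G.
Proof.
rewrite chordal_inT; split.
  by apply: injm_chordal_in (injm_subg G) _ _; rewrite ?subsetT.
apply: injm_chordal_in (injm_sgval G) _ _; first exact: subsetT.
by rewrite im_sgval.
Qed.

Definition lift_perm_morphism n (i : 'I_n.+1) : {morphism [set: 'S_n] >-> 'S_n.+1} :=
  Morphism (in2W (fun s t => esym (lift_permM i i i s t))).

Lemma injm_lift_perm n (i : 'I_n.+1) : 'injm (lift_perm_morphism i).
Proof.
apply/injmP=> s t _ _ /= eq_st; apply/permP=> x.
by apply: (@lift_inj _ i); rewrite -!(lift_perm_lift i i) eq_st.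
Qed.

Lemma chordal_Sym_le m n : m <= n ->
  chordal (@power_graph 'S_n) -> chordal (@power_graph 'S_m).
Proof.
elim: n => [|n IHn]; first by rewrite leqn0 => /eqP->.
rewrite leq_eqVlt ltnS => /predU1P[-> // | le_mn] chn.
apply: IHn => //; move: chn; rewrite !chordal_inT.
by apply: injm_chordal_in (injm_lift_perm ord_max) _ _; rewrite ?subsetT.
Qed.

Lemma chordal_Alt_le m n : m <= n ->
  chordal_in 'Alt_('I_n) -> chordal_in 'Alt_('I_m).
Proof.
elim: n => [|n IHn]; first by rewrite leqn0 => /eqP->.
rewrite leq_eqVlt ltnS => /predU1P[-> // | le_mn] chn.
apply: IHn => //; move: chn.
apply: injm_chordal_in (injm_lift_perm ord_max) _ _; first exact: subsetT.
apply/subsetP=> _ /morphimP[s _ + ->]; rewrite !Alt_even /=.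
by rewrite odd_lift_perm addbb.
Qed.

(** * Alternation along an induced cycle *)

Lemma val_iter_ordS k (i : 'I_k) m : iter m (@ordS k) i = (i + m) %% k :> nat.
Proof.
elim: m => [|m IHm] /=; first by rewrite addn0 modn_small.
by rewrite IHm -addn1 modnDml addn1 addnS.
Qed.

Lemma iter_ordS_neq k (i : 'I_k) m : 0 < m < k -> iter m (@ordS k) i != i.
Proof.
case/andP=> m0 mk; rewrite -val_eqE /= val_iter_ordS.
rewrite -[X in _ != X](modn_small (ltn_ord i)) -[X in _ != X %% k]addn0.
by rewrite eqn_modDl mod0n modn_small // -lt0n.
Qed.

(** The index names the vertex before the peak, so that no predecessor on the
    cycle is needed: the peak itself is [c (ordS i)]. *)
Definition peak (gT : finGroupType) k (c : 'I_k -> gT) (i : 'I_k) : bool :=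
  (c i \in <[c (ordS i)]>) && (c (ordS (ordS i)) \in <[c (ordS i)]>).

(** Modulo [k], with [k] at least 4, the number 2 is none of 0, 1 and -1, so an
    inclusion here would be a chord. *)
Lemma induced_cycle_skip (gT : finGroupType) k (c : 'I_k -> gT) (i : 'I_k) :
  4 <= k -> induced_cycle (@power_graph gT) c ->
  (c i \notin <[c (ordS (ordS i))]>) /\ (c (ordS (ordS i)) \notin <[c i]>).
Proof.
move=> k4 [injc adjc].
suffices nadj : ~ (c i \in <[c (ordS (ordS i))]> \/ c (ordS (ordS i)) \in <[c i]>).
  by split; apply/negP=> h; apply: nadj; [left | right].
move=> comp; have : power_graph (c i) (c (ordS (ordS i))).
  rewrite power_graphP; split=> // /injc/esym/eqP.
  by apply/negP; apply: (@iter_ordS_neq _ i 2); rewrite (ltnW k4).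
rewrite adjc => -[/ordS_inj/eqP | /esym/eqP]; apply/negP.
  by apply: (@iter_ordS_neq _ i 1); rewrite (ltn_trans _ k4).
exact: (@iter_ordS_neq _ i 3).
Qed.

(** An ascending edge is followed by a descending one and conversely, because
    otherwise transitivity would relate vertices two steps apart. *)
Lemma induced_cycle_peaks (gT : finGroupType) k (c : 'I_k -> gT) :
  4 <= k -> induced_cycle (@power_graph gT) c ->
  exists i, [/\ peak c i, peak c (ordS (ordS i))
              & peak c (ordS (ordS (ordS (ordS i))))].
Proof.
move=> k4 cy; have skip i := induced_cycle_skip i k4 cy.
have [injc adjc] := cy.
have edge i : (c i \in <[c (ordS i)]>) || (c (ordS i) \in <[c i]>).
  have /power_graphP[_ adj] : power_graph (c i) (c (ordS i)).
    by apply/adjc; left.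
  exact/orP.
have up_down i : c i \in <[c (ordS i)]> -> c (ordS (ordS i)) \in <[c (ordS i)]>.
  move=> up; have /orP[upS | //] := edge (ordS i).
  have [/negP[]] := skip i.
  by move: up upS; rewrite -!cycle_subG; apply: subset_trans.
have down_up i : c (ordS i) \in <[c i]> -> c (ordS i) \in <[c (ordS (ordS i))]>.
  move=> down; have /orP[//|downS] := edge (ordS i).
  have [_ /negP[]] := skip i.
  by move: downS down; rewrite -!cycle_subG; apply: subset_trans.
have peakS i : peak c i -> peak c (ordS (ordS i)).
  case/andP=> _ /down_up up; apply/andP; split=> //; exact: up_down.
have [i pi] : exists i, peak c i.
  pose i0 : 'I_k := Ordinal (ltn_trans (isT : 0 < 3) k4).
  have /orP[up | /down_up up] := edge i0; first by exists i0; rewrite /peak up up_down.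
  by exists (ordS i0); rewrite /peak up up_down.
by exists i; rewrite !peakS.
Qed.

(** A peak dominates two incomparable elements, so its order is not a prime
    power and is therefore 6.  Its two neighbours have orders 2 and 3, and the
    one of order 2 forces two successive peaks to generate the same group. *)
Lemma chordal_in_order6 (gT : finGroupType) (G : {group gT}) :
  {in G, forall z, (exists2 p, prime p & p.-nat #[z]) \/ #[z] = 6} ->
  {in G &, forall z w, #[z] = 6 -> #[w] = 6 ->
     forall t, #[t] = 2 -> t \in <[z]> -> t \in <[w]> -> <[z]> = <[w]>} ->
  chordal_in G.
Proof.
move=> ord6 uniq6 k c k4 cG cy.
have skip i := induced_cycle_skip i k4 cy.
(* In a cyclic group, inclusion of subgroups is divisibility of orders. *)
have incomp (z u v : gT) :
    u \in <[z]> -> v \in <[z]> -> u \notin <[v]> -> ~~ (#[u] %| #[v]).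
  rewrite -!cycle_subG => uz vz; apply: contraNN.
  by rewrite (cardSg_cyclic (cycle_cyclic z)).
have order_peak i : peak c i -> #[c (ordS i)] = 6.
  case/andP=> uz vz; have [uv vu] := skip i.
  have [[p pr_p pz]|//] := ord6 _ (cG (ordS i)).
  have pow x : x \in <[c (ordS i)]> -> exists e, #[x] = (p ^ e)%N.
    move=> xz; have /p_natP[e ->] : p.-nat #[x]; last by exists e.
    by apply: pnat_dvd pz; apply: order_dvdG.
  have [[e1 oe1] [e2 oe2]] := (pow _ uz, pow _ vz).
  have := incomp _ _ _ uz vz uv; have := incomp _ _ _ vz uz vu.
  rewrite oe1 oe2 !dvdn_Pexp2l ?prime_gt1 // -!ltnNge => lt12 lt21.
  by move: (ltn_trans lt12 lt21); rewrite ltnn.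
(* Three consecutive peaks x1, x3, x5 are used: the element of order 2 below
   the middle one is shared either with x1 or with x5. *)
have [i [p0 p2 p4]] := induced_cycle_peaks k4 cy.
have [[o1 o3] o5] := (order_peak _ p0, order_peak _ p2, order_peak _ p4).
set x1 := c (ordS i) in o1; set x3 := c (ordS (ordS (ordS i))) in o3.
set x5 := c (ordS _) in o5.
have [[/andP[_ x21] /andP[x23 x43]] /andP[x45 _]] := (p0, p2, p4).
have [n24 n42] := skip (ordS (ordS i)).
move: (incomp _ _ _ x23 x43 n24) (incomp _ _ _ x43 x23 n42).
have := order_dvdG x23; have := order_dvdG x43.
have dvd6 d : d %| #|<[x3]>| -> d \in [:: 1; 2; 3; 6]%N.
  by rewrite -[#|_|]/#[x3] o3 dvdn_divisors.
move=> /dvd6 d4 /dvd6 d2 nd24 nd42.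
have : (#[c (ordS (ordS i))] == 2) || (#[c (ordS (ordS (ordS (ordS i))))] == 2).
  by move: d2 d4 nd24 nd42; rewrite !inE => /or4P[]/eqP-> /or4P[]/eqP->.
case/orP=> /eqP o2.
  have [/negP[]] := skip (ordS i); rewrite -/x1 -/x3.
  by rewrite -(uniq6 _ _ (cG _) (cG _) o1 o3 _ o2 x21 x23) cycle_id.
have [/negP[]] := skip (ordS (ordS (ordS i))); rewrite -/x3 -/x5.
by rewrite -(uniq6 _ _ (cG _) (cG _) o3 o5 _ o2 x43 x45) cycle_id.
Qed.

(** * Cycle types of permutations *)

Definition cycle_type (T : finType) (s : {perm T}) : seq nat :=
  map (fun A : {set T} => #|A|) (enum (porbits s)).

Lemma permX_fixE (T : finType) (s : {perm T}) m x :
  ((s ^+ m) x == x) = (#|porbit s x| %| m).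
Proof.
set d := #|_|; have d_gt0 : 0 < d by rewrite lt0n card_porbit_neq0.
have iter_mul q : iter (q * d) s x = x.
  by elim: q => // q IHq; rewrite mulSn iterD IHq iter_porbit.
rewrite permX {1}(divn_eq m d) addnC iterD iter_mul /dvdn.
have lt_r : m %% d < d by rewrite ltn_mod.
have := uniq_traject_porbit s x; rewrite -/d => /(nth_uniq x) uniq_nth.
rewrite -(nth_traject s lt_r) -[X in _ == X]/(iter 0 s x) -(nth_traject s d_gt0).
by rewrite uniq_nth ?size_traject.
Qed.

Lemma mem_cycle_type (T : finType) (s : {perm T}) x : #|porbit s x| \in cycle_type s.
Proof. by apply: map_f; rewrite mem_enum imset_f. Qed.

Lemma cycle_typeP (T : finType) (s : {perm T}) d :
  reflect (exists x, d = #|porbit s x|) (d \in cycle_type s).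
Proof.
apply: (iffP mapP) => [[A] | [x ->]].
  by rewrite mem_enum => /imsetP[x _ ->] ->; exists x.
by exists (porbit s x); rewrite // mem_enum imset_f.
Qed.

Lemma permX_eq1 (T : finType) (s : {perm T}) m :
  (s ^+ m == 1) = all (fun d => d %| m) (cycle_type s).
Proof.
apply/eqP/allP=> [sm1 _ /cycle_typeP[x ->] | dv].
  by rewrite -permX_fixE sm1 perm1.
by apply/permP=> x; rewrite perm1; apply/eqP; rewrite permX_fixE dv ?mem_cycle_type.
Qed.

(** A cycle of length [d] is fixed pointwise by the [m]-th power if [d] divides
    [m], and moved entirely otherwise. *)
Lemma card_permX_fix (T : finType) (s : {perm T}) m :
  #|[set x | (s ^+ m) x == x]| = sumn [seq d <- cycle_type s | d %| m].
Proof.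
rewrite sumnE big_filter big_map big_enum_cond -sum1_card /=.
rewrite (partition_big (porbit s) (fun A => (A \in porbits s) && (#|A| %| m))) /=.
  apply: eq_bigr => A /andP[/imsetP[y _ ->{A}] dvm].
  rewrite -sum1_card; apply: eq_bigl => x.
  rewrite inE permX_fixE eq_porbit_mem andbC -eq_porbit_mem.
  by case: eqP => [-> | //]; rewrite dvm.
by move=> x; rewrite inE permX_fixE imset_f.
Qed.

Lemma sumn_cycle_type (T : finType) (s : {perm T}) : sumn (cycle_type s) = #|T|.
Proof.
have := card_permX_fix s 0; rewrite (eq_filter (a2 := predT)); last exact: dvdn0.
by rewrite filter_predT => <-; apply: eq_card => x; rewrite !inE expg0 perm1 eqxx.
Qed.

Lemma cycle_type_gt0 (T : finType) (s : {perm T}) : all (leq 1) (cycle_type s).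
Proof. by apply/allP=> _ /cycle_typeP[x ->]; rewrite lt0n card_porbit_neq0. Qed.

Lemma odd_perm_cycle_type (T : finType) (s : {perm T}) :
  odd_perm s = odd #|T| (+) odd (size (cycle_type s)).
Proof. by rewrite size_map -cardE. Qed.

(** The possible cycle types are enumerated through the compositions of [n]: a
    composition of [n.+1] either starts with 1 or arises from one of [n] by
    incrementing its first part. *)
Fixpoint compositions n : seq (seq nat) :=
  if n is m.+1 then
    [seq 1%N :: l | l <- compositions m] ++
    [seq (head 0%N l).+1 :: behead l | l <- compositions m & l != [::]]
  else [:: [::]].

Lemma mem_compositions (l : seq nat) :
  all (leq 1) l -> l \in compositions (sumn l).
Proof.
move: {2}(sumn l) (erefl (sumn l)) => n; elim: n l => [|n IHn] [|a l] //=.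
  by case: a.
case: a => // -[|a] sum_l /andP[_ l_gt0].
  by rewrite add1n /= mem_cat map_f // IHn //; case: sum_l.
rewrite /= mem_cat; apply/orP; right; apply/mapP; exists (a.+1 :: l) => //.
by rewrite mem_filter /= (IHn (a.+1 :: l)) //; case: sum_l.
Qed.

(** The first alternative makes the order divide a prime power.  The second one
    is there for the types 3+2 and 3+2+2: the cube of the permutation fixes three
    points, and each point is fixed by its square or by its cube. *)
Definition tame_type (l : seq nat) : bool :=
  has (fun q => all (fun d => d %| q) l) [:: 3; 4; 5; 7]%N ||
  all (fun d => d \in [:: 1; 2; 3]%N) l &&
    (sumn [seq d <- l | d %| 3] == 3).

Lemma tame_type5 l : l \in compositions 5 -> tame_type l.
Proof. by move: l; apply/allP; vm_compute. Qed.

(** As 7 is odd, the even permutations are those with an odd number of cycles: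
    this excludes 6+1, 5+2, 4+3 and 3+2+1+1. *)
Lemma tame_type7 l : l \in compositions 7 -> odd (size l) -> tame_type l.
Proof.
move=> l7; apply/implyP; move: l l7.
by apply/(allP (a := fun l => odd (size l) ==> tame_type l)); vm_compute.
Qed.

Lemma tame_order (T : finType) (s : {perm T}) :
  tame_type (cycle_type s) -> (exists2 p, prime p & p.-nat #[s]) \/ #[s] = 6.
Proof.
have ord q : all (fun d => d %| q) (cycle_type s) -> #[s] %| q.
  by rewrite -permX_eq1 order_dvdn.
case/orP=> [/hasP[q] | /andP[/allP d123 _]].
  rewrite !inE => /or4P q_in /ord os; left; exists (pdiv q).
    by apply: pdiv_prime; case: q_in => /eqP->.
  by apply: pnat_dvd os _; case: q_in => /eqP->.
have : #[s] %| 6.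
  by apply/ord/allP=> d /d123; rewrite !inE => /or3P[]/eqP->.
have : #[s] \in divisors 6 -> (exists2 p, prime p & p.-nat #[s]) \/ #[s] = 6.
  rewrite !inE => /or4P[]/eqP->;
    by [left; exists 2 | left; exists 2 | left; exists 3 | right].
by rewrite -dvdn_divisors.
Qed.

(** Otherwise the product of the two subgroups would have 9 elements, more than
    the 3! permutations with support in [F]. *)
Lemma Sym3_cycle_uniq (T : finType) (F : {set T}) (a b : {perm T}) :
  #|F| = 3 -> a \in perm.Sym F -> b \in perm.Sym F -> #[a] = 3 -> #[b] = 3 ->
  <[a]> = <[b]>.
Proof.
move=> F3 aF bF a3 b3; apply/eqP; rewrite eqEcard -!/#[_] a3 b3 leqnn andbT.
apply: contraT => nsub.
have tiab : <[a]> :&: <[b]> = 1 by apply: prime_TIg => //; rewrite -/#[a] a3.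
have := mul_cardG <[a]> <[b]>; rewrite tiab cards1 -!/#[_] a3 b3 muln1 => card_ab.
have : #|<[a]> * <[b]>| <= #|perm.Sym F|.
  by apply: subset_leq_card; rewrite mul_subG ?cycle_subG.
by rewrite -card_ab perm.card_Sym F3.
Qed.

(** The element of order 2 in [<[z]>] is [z ^+ 3], so its set [F] of fixed
    points is the same for [z] and [w]; there are three of them.  Both squares
    are 3-cycles on [F], so they generate the same group, and [z] is the product
    of its cube and of the inverse of its square. *)
Lemma tame_uniq (T : finType) (z w : {perm T}) :
  tame_type (cycle_type z) -> tame_type (cycle_type w) ->
  #[z] = 6 -> #[w] = 6 ->
  forall t, #[t] = 2 -> t \in <[z]> -> t \in <[w]> -> <[z]> = <[w]>.
Proof.
move=> tame_z tame_w oz ow t ot tz tw.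
have cube (s : {perm T}) : #[s] = 6 -> t \in <[s]> -> t = s ^+ 3.
  move=> os /cyclePmin[m]; rewrite os => m_lt def_t.
  move: ot; rewrite {}def_t; case: m m_lt => [|[|[|[|[|[|]]]]]] // _;
    by rewrite ?expg0 ?expg1 ?order1 ?orderXgcd ?os.
pose F := [set x | t x == x].
have tame6 (s : {perm T}) : tame_type (cycle_type s) -> #[s] = 6 -> t = s ^+ 3 ->
    #|F| = 3 /\ s ^+ 2 \in perm.Sym F.
  move=> tame os def_t; case/orP: tame => [/hasP[q] | /andP[/allP d123 /eqP F3]].
    by rewrite !inE -permX_eq1 -order_dvdn os => /or4P[]/eqP->.
  rewrite /F def_t card_permX_fix; split=> //.
  rewrite inE; apply/subsetP=> x; rewrite !inE !permX_fixE.
  by have := d123 _ (mem_cycle_type s x); rewrite !inE => /or3P[]/eqP->.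
have [F3 z2F] := tame6 _ tame_z oz (cube _ oz tz).
have [_ w2F] := tame6 _ tame_w ow (cube _ ow tw).
have z2w : <[z ^+ 2]> = <[w ^+ 2]>.
  by apply: Sym3_cycle_uniq F3 _ _ _ _; rewrite ?orderXgcd ?oz ?ow.
apply/eqP; rewrite eqEcard -!/#[_] oz ow leqnn andbT cycle_subG.
have -> : z = t * (z ^+ 2)^-1 by rewrite (cube z) // expgS mulgK.
by rewrite groupMl // groupV -cycle_subG z2w cycle_subG mem_cycle.
Qed.

Lemma chordal_Sym5 : chordal_in [set: 'S_5].
Proof.
have tame (s : 'S_5) : tame_type (cycle_type s).
  apply: tame_type5; have := mem_compositions (cycle_type_gt0 s).
  by rewrite sumn_cycle_type card_ord.
apply: chordal_in_order6 => [z _ | z w _ _]; [exact: tame_order | exact: tame_uniq].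
Qed.

Lemma chordal_Alt7 : chordal_in 'Alt_('I_7).
Proof.
have tame (s : 'S_7) : s \in 'Alt_('I_7) -> tame_type (cycle_type s).
  move=> sA; apply: tame_type7.
    have := mem_compositions (cycle_type_gt0 s).
    by rewrite sumn_cycle_type card_ord.
  by move: sA; rewrite Alt_even odd_perm_cycle_type card_ord negbK.
apply: chordal_in_order6 => [z zA | z w zA wA]; [apply: tame_order | apply: tame_uniq];
  exact: tame.
Qed.

(** * Induced cycles from commuting elements *)

(** On the cycle of length 2k, position 2h carries s_h and position 2h+1 carries
    s_h s_(h+1); [half_ord] extracts h. *)
Definition half_ord k (i : 'I_k.*2) : 'I_k :=
  Ordinal (etrans (ltn_half_double i k) (ltn_ord i)).

Lemma eq_ord_half k (i j : 'I_k.*2) :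
  odd i = odd j -> half_ord i = half_ord j -> i = j.
Proof.
move=> eq_odd [eq_half]; apply: val_inj.
by rewrite /= -(odd_double_half i) -(odd_double_half j) eq_odd eq_half.
Qed.

Lemma odd_ordS k (i : 'I_k.*2) : odd (ordS i) = ~~ odd i.
Proof. by rewrite /= odd_mod ?odd_double. Qed.

Lemma half_ordS k (i : 'I_k.*2) :
  half_ord (ordS i) = if odd i then ordS (half_ord i) else half_ord i.
Proof.
have def_i := odd_double_half i.
case: ifP def_i => [_ | _]; rewrite ?add0n ?add1n => def_i; apply: val_inj => /=.
  rewrite -{1}def_i; move: i./2 => h.
  by rewrite -doubleS -(muln2 h.+1) -(muln2 k) -muln_modl muln2 doubleK.
rewrite modn_small; first by rewrite -{1}def_i; exact: uphalf_double.
by rewrite -{1}def_i ltn_Sdouble ltn_half_double.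
Qed.

(** By coprimality, s_i and s_(i+1) are powers of s_i s_(i+1).  Hence any
    inclusion between the cyclic groups of two vertices turns into statements
    s_j \in <[s_i s_(i+1)]>, and the last hypothesis leaves only the inclusions
    of the s_i in their two neighbours. *)
Lemma not_chordal_commuting_cycle (gT : finGroupType) (G : {group gT}) k
    (s : 'I_k -> gT) : 3 <= k ->
  (forall i, s i \in G) ->
  (forall i, commute (s i) (s (ordS i))) ->
  (forall i, coprime #[s i] #[s (ordS i)]) ->
  (forall i j, s j \in <[s i * s (ordS i)]> -> j = i \/ j = ordS i) ->
  ~ chordal_in G.
Proof.
move=> k3 sG com cop sep chG; pose p i := s i * s (ordS i).
have neqS (i : 'I_k) : ordS i <> i.
  by apply/eqP; apply: (@iter_ordS_neq _ i 1); rewrite (ltn_trans _ k3).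
have neqSS (i : 'I_k) : ordS (ordS i) <> i.
  by apply/eqP; apply: (@iter_ordS_neq _ i 2).
have memp i : (s i \in <[p i]>) && (s (ordS i) \in <[p i]>).
  rewrite /p (cycleM (com i) (cop i)).
  by rewrite (subsetP (mulG_subl _ _)) ?(subsetP (mulG_subr _ _)) ?cycle_id.
have trans x y z : x \in <[y]> -> y \in <[z]> -> x \in <[z : gT]>.
  by rewrite -!cycle_subG; apply: subset_trans.
have ss i j : s i \in <[s j]> -> i = j.
  move=> sij; rewrite -(ord_predK j) in sij *; set j' := ord_pred j in sij *.
  have /andP[mj' mSj'] := memp j'; have /andP[mSj _] := memp (ordS j').
  have [ij' | //] := sep _ _ (trans _ _ _ sij mSj').
  have [// | iSSj'] := sep _ _ (trans _ _ _ sij mSj).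
  by case: (neqSS j'); rewrite -iSSj' ij'.
have ps i j : p i \notin <[s j]>.
  apply/negP=> pij; have /andP[/trans mi /trans mSi] := memp i.
  by apply: (neqS i); rewrite (ss _ _ (mSi _ pij)) -(ss _ _ (mi _ pij)).
have pp i j : p i \in <[p j]> -> i = j.
  move=> pij; have /andP[/trans mi /trans mSi] := memp i.
  have [// | iSj] := sep _ _ (mi _ pij).
  have [Sij | /ordS_inj//] := sep _ _ (mSi _ pij).
  by case: (neqSS j); rewrite -iSj.
have sp i j : s j \in <[p i]> <-> j = i \/ j = ordS i.
  by split=> [/sep // | [] ->]; have /andP[] := memp i.
pose c (i : 'I_k.*2) := if odd i then p (half_ord i) else s (half_ord i).
apply: (chG k.*2 c).
- by rewrite (leq_trans _ (_ : 3.*2 <= _)) // leq_double.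
- by move=> i; rewrite /c; case: ifP => _; rewrite ?groupM.
have injc i j : c i = c j -> i = j.
  move=> eq_c; have := cycle_id (c i); rewrite {2}eq_c; have := cycle_id (c j).
  rewrite -{2}eq_c {eq_c} /c; case: ifP => oi; case: ifP => oj.
  - by move=> _ /pp; apply: eq_ord_half; rewrite oi oj.
  - by rewrite [p _ \in _](negPf (ps _ _)).
  - by move=> _; rewrite [p _ \in _](negPf (ps _ _)).
  - by move=> _ /ss; apply: eq_ord_half; rewrite oi oj.
have par (i j : 'I_k.*2) : j = ordS i -> odd j = ~~ odd i by move->; exact: odd_ordS.
have mixed (i j : 'I_k.*2) : odd i -> ~~ odd j ->
    power_graph (c i) (c j) <-> (j = ordS i \/ i = ordS j).
  move=> oi oj; rewrite power_graphP /c oi (negPf oj).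
  rewrite [p _ \in _](negPf (ps _ _)) sp; split.
    case=> _ [// | [eq_h | eq_h]].
      by right; apply: eq_ord_half; rewrite ?odd_ordS ?half_ordS ?oi ?(negPf oj).
    by left; apply: eq_ord_half; rewrite ?odd_ordS ?half_ordS ?oi ?(negPf oj).
  move=> adj; split.
    by move=> eq_ps; have := cycle_id (p (half_ord i)); rewrite {2}eq_ps (negPf (ps _ _)).
  right; case: adj => ->; rewrite half_ordS ?oi ?(negPf oj); [by right | by left].
split=> // i j; case oi: (odd i); case oj: (odd j).
- split=> [| []/par]; rewrite ?oi ?oj // power_graphP /c oi oj.
  by case=> neq [] /pp eq_h; case: neq; rewrite eq_h.
- by apply: mixed; rewrite ?oi ?oj.
- by rewrite power_graph_sym or_comm; apply: mixed; rewrite ?oi ?oj.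
- split=> [| []/par]; rewrite ?oi ?oj // power_graphP /c oi oj.
  by case=> neq [] /ss eq_h; case: neq; rewrite eq_h.
Qed.

(** Used with a function constant on the orbits of [g], this shows that a
    permutation mixing these orbits is not a power of [g]. *)
Lemma mem_cycle_invariant (T : finType) (rT : Type) (f : T -> rT) (g y : {perm T}) :
  (forall x, f (g x) = f x) -> y \in <[g]> -> forall x, f (y x) = f x.
Proof.
move=> fg /cycleP[m ->] x; elim: m => [|m IHm]; first by rewrite expg0 perm1.
by rewrite expgSr permM fg.
Qed.

(** * Explicit cycles in Sym(6) and Alt(8) *)

Definition swap n (a b : nat) : 'S_n.+1 := tperm (inord a) (inord b).

Definition cycle3 n (a b d : nat) : 'S_n.+1 := swap n a b * swap n a d.

Lemma swapE n a b (x : 'I_n.+1) : a <= n -> b <= n ->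
  swap n a b x = (if x == a :> nat then b else if x == b :> nat then a else x) :> nat.
Proof.
move=> an bn; rewrite /swap; case: tpermP => [->|->|/eqP + /eqP].
- by rewrite !inordK // eqxx.
- by rewrite !inordK // eqxx; case: eqP.
by rewrite -!val_eqE /= !inordK // => /negPf-> /negPf->.
Qed.

Lemma odd_swap n a b : a <= n -> b <= n -> odd_perm (swap n a b) = (a != b).
Proof. by move=> an bn; rewrite odd_tperm -val_eqE /= !inordK. Qed.

Lemma coprime_order (gT : finGroupType) (a b : gT) m n :
  coprime m n -> a ^+ m = 1 -> b ^+ n = 1 -> coprime #[a] #[b].
Proof.
move=> co_mn /eqP; rewrite -order_dvdn => am /eqP; rewrite -order_dvdn => bn.
exact: coprime_dvdl am (coprime_dvdr bn co_mn).
Qed.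

Ltac ord_cases i :=
  let m := fresh "m" in let lt_m := fresh "lt_m" in
  case: i => m lt_m; do 8?[case: m lt_m => [|m] lt_m //].

Ltac check_perm :=
  rewrite /= /cycle3 ?expgS ?expg0 ?mulg1; 
  let x := fresh "x" in apply/permP => x; apply/val_inj;
  rewrite ?permM ?perm1 /= ?(permM, swapE) //; ord_cases x.

(** The transpositions (0 a) and the 3-cycles (4 5 b), with a and b in
    {1, 2, 3}: they commute when a and b differ, and the order below alternates
    them so that consecutive a and b differ. *)
Definition sym6_cycle (i : 'I_6) : 'S_6 :=
  nth 1 [:: swap 5 0 1; cycle3 5 4 5 3; swap 5 0 2; cycle3 5 4 5 1;
            swap 5 0 3; cycle3 5 4 5 2] i.

(** Entry [i] numbers the orbits of the product of the elements [i] and [i + 1]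
    of the sequence: 0 for the transposition, 1 for the 3-cycle, 2 for the fixed
    point. *)
Definition sym6_orbit (i : 'I_6) (x : 'I_6) : nat :=
  nth 0 (nth [::] [:: [:: 0; 0; 2; 1; 1; 1]; [:: 0; 2; 0; 1; 1; 1];
                      [:: 0; 1; 0; 2; 1; 1]; [:: 0; 1; 2; 0; 1; 1];
                      [:: 0; 2; 1; 0; 1; 1]; [:: 0; 0; 1; 2; 1; 1]]%N i) x.

Lemma not_chordal_Sym6 : ~ chordal_in [set: 'S_6].
Proof.
apply: (@not_chordal_commuting_cycle _ _ 6 sym6_cycle) => // [i | i | i | i j].
- exact: in_setT.
- by rewrite /commute /sym6_cycle; ord_cases i; check_perm.
- rewrite /sym6_cycle; ord_cases i; rewrite /=;
    first [ by apply: (@coprime_order _ _ _ 2 3) => //; check_perm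
          | by apply: (@coprime_order _ _ _ 3 2) => //; check_perm ].
have inv x :
    sym6_orbit i ((sym6_cycle i * sym6_cycle (ordS i)) x) = sym6_orbit i x.
  rewrite /sym6_orbit /sym6_cycle; ord_cases i;
    rewrite /= /cycle3 ?(permM, swapE) //; ord_cases x.
move/(mem_cycle_invariant inv)=> {inv} inv_j.
(* Every involution of the sequence moves 0 and every 3-cycle moves 5, to a
   different orbit unless it is one of the two factors. *)
move: (inv_j (inord 0)) (inv_j (inord 5)) => {inv_j}.
rewrite /sym6_orbit /sym6_cycle; ord_cases i; ord_cases j;
  rewrite /= /cycle3 ?(permM, swapE, inordK) //=;
  by [move=> _ _; left; apply: val_inj | move=> _ _; right; apply: val_inj].
Qed.

(** Two double transpositions with support {0, 1, 2, 3} and two 3-cycles in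
    {4, 5, 6, 7}. *)
Definition alt8_cycle (i : 'I_4) : 'S_8 :=
  nth 1 [:: swap 7 0 1 * swap 7 2 3; cycle3 7 4 5 6;
            swap 7 0 2 * swap 7 1 3; cycle3 7 4 5 7] i.

(** Entry [i] numbers the orbits of the product of the elements [i] and [i + 1]
    of the sequence, 3 being the fixed point. *)
Definition alt8_orbit (i : 'I_4) (x : 'I_8) : nat :=
  nth 0 (nth [::] [:: [:: 0; 0; 1; 1; 2; 2; 2; 3]; [:: 0; 1; 0; 1; 2; 2; 2; 3];
                      [:: 0; 1; 0; 1; 2; 2; 3; 2]; [:: 0; 0; 1; 1; 2; 2; 3; 2]]%N i) x.

Lemma not_chordal_Alt8 : ~ chordal_in 'Alt_('I_8).
Proof.
apply: (@not_chordal_commuting_cycle _ _ 4 alt8_cycle) => // [i | i | i | i j].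
- by rewrite Alt_even /alt8_cycle; ord_cases i; rewrite /= /cycle3 odd_permM !odd_swap.
- by rewrite /commute /alt8_cycle; ord_cases i; check_perm.
- rewrite /alt8_cycle; ord_cases i; rewrite /=;
    first [ by apply: (@coprime_order _ _ _ 2 3) => //; check_perm
          | by apply: (@coprime_order _ _ _ 3 2) => //; check_perm ].
have inv x :
    alt8_orbit i ((alt8_cycle i * alt8_cycle (ordS i)) x) = alt8_orbit i x.
  rewrite /alt8_orbit /alt8_cycle; ord_cases i;
    rewrite /= /cycle3 ?(permM, swapE) //; ord_cases x.
move/(mem_cycle_invariant inv)=> {inv} inv_j.
(* Every involution of the sequence moves 0 and every 3-cycle moves 5, to a
   different orbit unless it is one of the two factors. *)
move: (inv_j (inord 0)) (inv_j (inord 5)) => {inv_j}.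
rewrite /alt8_orbit /alt8_cycle; ord_cases i; ord_cases j;
  rewrite /= /cycle3 ?(permM, swapE, inordK) //=;
  by [move=> _ _; left; apply: val_inj | move=> _ _; right; apply: val_inj].
Qed.

Theorem lemma4p1 :
  (forall n : nat, chordal (@power_graph 'S_n) <-> n <= 5) /\
  (forall n : nat, chordal (@power_graph (subg_of 'Alt_('I_n)%G)) <-> n <= 7).
Proof.
split=> n.
  split=> [chn | le_n5]; last first.
    exact/(chordal_Sym_le le_n5)/chordal_inT/chordal_Sym5.
  rewrite leqNgt; apply/negP=> n6; apply: not_chordal_Sym6.
  exact/chordal_inT/(chordal_Sym_le n6).
rewrite chordal_subg; split=> [chn | le_n7]; last first.
  exact: chordal_Alt_le le_n7 chordal_Alt7.
by rewrite leqNgt; apply/negP=> n8; apply/not_chordal_Alt8/(chordal_Alt_le n8).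
Qed.
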